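(* Let $X$ be a bounded commutative BCK-algebra, and let $\Im$ and $\Im'$ be the Baig topologies on $X$-modules $M$ and $M'$ admitted by decreasing sequences of submodules $(M_n)_{n\in\mathbb{Z}^+}$ of $M$ and $(M'_n)_{n\in\mathbb{Z}^+}$ of $M'$ respectively. Then every strict $X$-homomorphism $f:M\to M'$ is continuous.
   Context: A BCK-algebra is a set $X$ with a binary operation $*$ and a constant $0$ such that for all $a,b,c\in X$: $((a*b)*(a*c))*(c*b)=0$; $(a*(a*b))*b=0$; $a*a=0$; $0*a=0$; and $a*b=0=b*a$ implies $a=b$. Write $a\le b$ iff $a*b=0$ (a partial order), and $a\wedge b=b*(b*a)$. $X$ is bounded if it has an element $1$ with $a\le 1$ for all $a\in X$, and commutative if $a\wedge b=b\wedge a$ for all $a,b\in X$. For a bounded commutative BCK-algebra $X$, an $X$-module is an abelian group $(M,+)$ with a map $X\times M\to M$, $(a,m)\mapsto am$, such that $(a\wedge b)m=a(bm)$, $a(m_1+m_2)=am_1+am_2$, $0m=0$ and $1m=m$ for all $a,b\in X$, $m,m_1,m_2\in M$. A submodule is a subgroup $N$ of $M$ that is an $X$-module under the same action. An $X$-homomorphism $f:M\to M'$ is a map with $f(m_1+m_2)=f(m_1)+f(m_2)$ and $f(xm)=xf(m)$ for all $x\in X$, $m,m_1,m_2\in M$. A decreasing sequence of submodules of $M$ is a family $(M_n)_{n\in\mathbb{Z}^+}$ of submodules with $M_{n+1}\subseteq M_n$ for all $n$. The Baig topology on $M$ admitted by it is $\{V\subseteq M : \forall v\in V\ \exists n\in\mathbb{Z}^+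 \text{ such that } v+M_n\subseteq V\}$. An $X$-homomorphism $f:M\to M'$ is strict (with respect to the two sequences) if $f(M_n)=f(M)\cap M'_n$ for all $n\in\mathbb{Z}^+$. *)

(* Defs.v *)
From HB Require Import structures.
From mathcomp Require Import all_boot all_algebra.
From mathcomp Require Import boolp classical_sets topology_structure.

Set Implicit Arguments.
Unset Strict Implicit.
Unset Printing Implicit Defensive.

Import GRing.Theory.

Declare Scope bck_scope.
Delimit Scope bck_scope with bck.

HB.mixin Record isBCK (X : Type) := {
  bck_op : X -> X -> X;
  bck0 : X;
  bck_opBB : forall a b c,
    bck_op (bck_op (bck_op a b) (bck_op a c)) (bck_op c b) = bck0;
  bck_opK : forall a b, bck_op (bck_op a (bck_op a b)) b = bck0;
  bck_opxx : forall a, bck_op a a = bck0;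
  bck_op0x : forall a, bck_op bck0 a = bck0;
  bck_op_anti : forall a b, bck_op a b = bck0 -> bck_op b a = bck0 -> a = b
}.

#[short(type="bckType")]
HB.structure Definition BCK := {X of isBCK X}.

Notation "a * b" := (bck_op a b) : bck_scope.
Notation "0" := bck0 : bck_scope.

Definition bck_le (X : bckType) (a b : X) : Prop := (a * b = 0)%bck.

Definition bck_meet (X : bckType) (a b : X) : X := (b * (b * a))%bck.

Notation "a <= b" := (bck_le a b) : bck_scope.
Notation "a `&` b" := (bck_meet a b) : bck_scope.

HB.mixin Record BCK_isBounded X & BCK X := {
  bck1 : X;
  bck_le1 : forall a : X, (a <= bck1)%bck
}.

#[short(type="boundedBCKType")]
HB.structure Definition BoundedBCK := {X of BCK X & BCK_isBounded X}.

Notation "1" := bck1 : bck_scope.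

HB.mixin Record BCK_isCommutative X & BCK X := {
  bck_meetC : forall a b : X, (a `&` b = b `&` a)%bck
}.

#[short(type="boundedCommutativeBCKType")]
HB.structure Definition BoundedCommutativeBCK :=
  {X of BoundedBCK X & BCK_isCommutative X}.

Local Open Scope classical_set_scope.
Local Open Scope ring_scope.

HB.mixin Record Zmodule_isXModule (X : boundedCommutativeBCKType) M
    & GRing.Zmodule M := {
  xact : X -> M -> M;
  xact_meet : forall (a b : X) (m : M),
    xact (a `&` b)%bck m = xact a (xact b m);
  xactD : forall (a : X) (m1 m2 : M),
    xact a (m1 + m2) = xact a m1 + xact a m2;
  xact0 : forall m : M, xact 0%bck m = 0;
  xact1 : forall m : M, xact 1%bck m = m
}.

#[short(type="xmodType")]
HB.structure Definition XModule (X : boundedCommutativeBCKType) :=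
  {M of GRing.Zmodule M & Zmodule_isXModule X M}.

(* A subgroup stable under the action satisfies the module identities, which
   it inherits from M; stability is what makes the restricted action
   well defined. *)
Record is_submodule (X : boundedCommutativeBCKType) (M : xmodType X)
    (N : set M) : Prop := {
  submodule0 : N 0;
  submoduleB : forall m1 m2, N m1 -> N m2 -> N (m1 - m2);
  submodule_act : forall (a : X) m, N m -> N (xact a m)
}.

Definition is_xhom (X : boundedCommutativeBCKType) (M M' : xmodType X)
    (f : M -> M') : Prop :=
  (forall m1 m2, f (m1 + m2) = f m1 + f m2) /\
  (forall (x : X) m, f (xact x m) = xact x (f m)).

(* The index set is the set of positive integers: the value at 0 is junk, and
   every quantification over indices below is restricted to 0 < n. *)
Record decreasing_submodules (X : boundedCommutativeBCKType)
    (M : xmodType X) := DecreasingSubmodules {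
  dsub :> nat -> set M;
  dsub_submodule : forall n, (0 < n)%N -> is_submodule (dsub n);
  dsub_decr : forall n, (0 < n)%N -> dsub n.+1 `<=` dsub n
}.

Definition is_strict (X : boundedCommutativeBCKType) (M M' : xmodType X)
    (Mn : decreasing_submodules M) (Mn' : decreasing_submodules M')
    (f : M -> M') : Prop :=
  forall n, (0 < n)%N -> f @` Mn n = range f `&` Mn' n.

Definition baig_open (X : boundedCommutativeBCKType) (M : xmodType X)
    (Mn : decreasing_submodules M) : set_system M :=
  [set V | forall v, V v ->
     exists2 n, (0 < n)%N & [set v + m | m in Mn n] `<=` V].

(* Alias of M bearing the topology of Mn, since M itself has no preferred
   topology. *)
Definition baig (X : boundedCommutativeBCKType) (M : xmodType X)
    (Mn : decreasing_submodules M) : Type := M.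

HB.instance Definition _ (X : boundedCommutativeBCKType) (M : xmodType X)
    (Mn : decreasing_submodules M) := Choice.on (baig Mn).

Lemma dsub_le (X : boundedCommutativeBCKType) (M : xmodType X)
    (Mn : decreasing_submodules M) (m n : nat) :
  (0 < m)%N -> (m <= n)%N -> Mn n `<=` Mn m.
Proof.
move=> m0 /subnK <-; elim: (n - m)%N => [//|k IHk].
rewrite addSn; apply: subset_trans IHk; apply: dsub_decr.
by rewrite addn_gt0 m0 orbT.
Qed.

Lemma baig_openT (X : boundedCommutativeBCKType) (M : xmodType X)
    (Mn : decreasing_submodules M) : baig_open Mn setT.
Proof. by move=> v _; exists 1%N. Qed.

Lemma baig_openI (X : boundedCommutativeBCKType) (M : xmodType X)
    (Mn : decreasing_submodules M) (A B : set M) :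
  baig_open Mn A -> baig_open Mn B -> baig_open Mn (A `&` B).
Proof.
move=> oA oB v [/oA[i i0 iA] /oB[j j0 jB]].
exists (maxn i j); first by rewrite leq_max i0.
move=> _ [m Mm <-]; split.
- by apply: iA; exists m => //; apply: dsub_le Mm; rewrite ?leq_maxl.
- by apply: jB; exists m => //; apply: dsub_le Mm; rewrite ?leq_maxr.
Qed.

Lemma baig_open_bigcup (X : boundedCommutativeBCKType) (M : xmodType X)
    (Mn : decreasing_submodules M) (I : Type) (F : I -> set M) :
  (forall i, baig_open Mn (F i)) -> baig_open Mn (\bigcup_i F i).
Proof.
move=> oF v [i _ /oF[n n0 nF]]; exists n => //.
by move=> x /nF Fx; exists i.
Qed.

HB.instance Definition _ (X : boundedCommutativeBCKType) (M : xmodType X)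
    (Mn : decreasing_submodules M) :=
  isOpenTopological.Build (baig Mn)
    (baig_openT Mn) (@baig_openI X M Mn) (@baig_open_bigcup X M Mn).

Lemma baig_openE (X : boundedCommutativeBCKType) (M : xmodType X)
    (Mn : decreasing_submodules M) : @open (baig Mn) = baig_open Mn.
Proof. by []. Qed.

(* Main.v *)
Require Import Defs.
From mathcomp Require Import all_boot all_algebra.
From mathcomp Require Import boolp classical_sets topology_structure.

(** A strict homomorphism maps the [n]-th submodule of the domain into the
    [n]-th submodule of the codomain, and an additive map with this property
    is continuous: it sends the basic neighbourhood [v + M_n] of [v] into the
    basic neighbourhood [f v + M'_n] of [f v], with the same [n], so the
    preimage of an open set is open. *)

Lemma strict_sub (X : boundedCommutativeBCKType) (M M' : xmodType X)
    (Mn : decreasing_submodules M) (Mn' : decreasing_submodules M')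
    (f : M -> M') (n : nat) (m : M) :
  is_strict Mn Mn' f -> (0 < n)%N -> Mn n m -> Mn' n (f m).
Proof.
move=> fS n0 Mm.
have : image (Mn n) f (f m) by exists m.
by rewrite fS // => -[].
Qed.

Lemma additive_sub_continuous (X : boundedCommutativeBCKType)
    (M M' : xmodType X)
    (Mn : decreasing_submodules M) (Mn' : decreasing_submodules M')
    (f : M -> M') :
  (forall m1 m2, f (m1 + m2)%R = (f m1 + f m2)%R) ->
  (forall n m, (0 < n)%N -> Mn n m -> Mn' n (f m)) ->
  continuous (f : baig Mn -> baig Mn').
Proof.
move=> fD fM; apply/continuousP => A; rewrite !baig_openE => oA v Afv.
have [n n0 nA] := oA _ Afv; exists n => // _ [m Mm <-].
by apply: nA; exists (f m); [exact: fM | rewrite fD].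
Qed.

Theorem corollary3p6 (X : boundedCommutativeBCKType) (M M' : xmodType X)
    (Mn : decreasing_submodules M) (Mn' : decreasing_submodules M')
    (f : M -> M') :
  is_xhom f -> is_strict Mn Mn' f ->
  continuous (f : baig Mn -> baig Mn').
Proof.
move=> [fD _] fS; apply: additive_sub_continuous => // n m.
exact: strict_sub.
Qed.
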